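(* Let $A\in\mathbb{R}^{m\times n}$ with $m\le n$, let $x\in\mathbb{R}^n$ and $b\in\mathbb{R}^m$, $b\neq 0$, satisfy $Ax=b$. Let $\{x_s\}_{s=1}^\infty$ be the sequence of approximating vectors produced by the SAP process. Then $$\lim_{s\to\infty}x_s=\bar{x},$$ where $\bar{x}$ is the orthogonal projection of $x$ onto the subspace $\operatorname{ran}(A')$ of $\mathbb{R}^n$. In particular, if $m=n$ and $A$ is nonsingular, then $\bar{x}=x$.
   Context: Notation: $A'$ denotes the transpose of $A$, $\operatorname{ran}(M)$ the column space of $M$, and $\|\cdot\|$ the Euclidean norm. Row blocks: the rows of $A$ are divided into $k$ blocks $A_1,\dots,A_k$ (each $A_i$ is a submatrix of $A$ consisting of some of its rows; different blocks may share rows; every row of $A$ lies in at least one block), and $b_1,\dots,b_k$ are the corresponding subvectors of $b$, so $A_ix=b_i$. One AP (accumulated projection) sweep started from a vector $p_0$: for $i=1,\dots,k$ let $W_i=[p_{i-1},A_i']$ and let $p_i$ be the orthogonal projection of $x$ onto $\operatorname{ran}(W_i)$ (so $p_i=W_i(W_i'W_i)^{-1}W_i'x$ when $W_i$ has full column rank). The output of the sweep is $p_k$. SAP (stationary accumulated projection) process, run without a stopping criterion: $x_0=\alpha A'b$ with $\alpha=\|b\|^2/\|A'b\|^2$, and for $s=0,1,2,\dots$ the vector $x_{s+1}$ is the output of one AP sweep started from $p_0=x_s$. *)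

(* Defs.v *)
From HB Require Import structures.
From mathcomp Require Import all_boot all_order all_algebra.
From mathcomp Require Import all_classical all_reals all_analysis.
Import Order.TTheory GRing.Theory Num.Theory.
Import numFieldNormedType.Exports.

Set Implicit Arguments.
Unset Strict Implicit.
Unset Printing Implicit Defensive.

Local Open Scope ring_scope.

Definition enorm (R : realType) (n : nat) (v : 'cV[R]_n) : R :=
  Num.sqrt (\sum_i v i ord0 ^+ 2).

(* Orthogonal projection of the column vector x onto ran(W), as in proj_ortho
   of spectral.v (which is restricted to numClosedFieldType). Subspaces are row
   spaces in mxalgebra, hence the transpositions; the row space of kermx W is
   { u | u *m W = 0 }, the orthogonal complement of ran(W). *)
Definition orthproj (R : realType) (n p : nat) (W : 'M[R]_(n, p))
    (x : 'cV[R]_n) : 'cV[R]_n :=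
  (x^T *m proj_mx <<W^T>>%MS (kermx W))^T.

Definition row_block (R : realType) (m n : nat) (A : 'M[R]_(m, n))
    (S : {set 'I_m}) : 'M[R]_(#|S|, n) :=
  rowsub (fun j : 'I_#|S| => enum_val j) A.

Definition ap_step (R : realType) (m n : nat) (A : 'M[R]_(m, n))
    (x p : 'cV[R]_n) (S : {set 'I_m}) : 'cV[R]_n :=
  orthproj (row_mx p (row_block A S)^T) x.

(* enum 'I_k is increasing, so the blocks are treated in the order
   B 0, ..., B (k - 1). *)
Definition ap_sweep (R : realType) (m n k : nat) (A : 'M[R]_(m, n))
    (B : 'I_k -> {set 'I_m}) (x p0 : 'cV[R]_n) : 'cV[R]_n :=
  foldl (fun p i => ap_step A x p (B i)) p0 (enum 'I_k).

Definition sap_init (R : realType) (m n : nat) (A : 'M[R]_(m, n))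
    (b : 'cV[R]_m) : 'cV[R]_n :=
  (enorm b ^+ 2 / enorm (A^T *m b) ^+ 2) *: (A^T *m b).

Definition sap (R : realType) (m n k : nat) (A : 'M[R]_(m, n))
    (B : 'I_k -> {set 'I_m}) (x : 'cV[R]_n) (b : 'cV[R]_m) (s : nat) :
    'cV[R]_n :=
  iter s (ap_sweep A B x) (sap_init A b).

Lemma mulmx_tr_eq0 (R : realType) (n : nat) (u : 'rV[R]_n) :
  u *m u^T = 0 -> u = 0.
Proof.
move=> /matrixP/(_ ord0 ord0); rewrite !mxE => /eqP.
under eq_bigr do rewrite mxE -expr2.
rewrite psumr_eq0; last by move=> i _; exact: sqr_ge0.
move=> /allP u0; apply/rowP => i; rewrite mxE; apply/eqP.
by have := u0 i (mem_index_enum _); rewrite sqrf_eq0.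
Qed.

Lemma ran_ker_disjoint (R : realType) (n p : nat) (W : 'M[R]_(n, p)) :
  (<<W^T>> :&: kermx W = 0)%MS.
Proof.
apply/eqP/rowV0P => u; rewrite sub_capmx genmxE => /andP[/submxP[c uE]].
move=> /sub_kermxP uM; apply: mulmx_tr_eq0.
by rewrite {2}uE trmx_mul trmxK mulmxA uM mul0mx.
Qed.

Lemma ran_ker_full (R : realType) (n p : nat) (W : 'M[R]_(n, p))
    (q : nat) (u : 'M[R]_(q, n)) :
  (u <= <<W^T>> + kermx W)%MS.
Proof.
rewrite submx_full // /row_full -[X in X == _]addn0.
have := mxrank_sum_cap <<W^T>>%MS (kermx W).
rewrite ran_ker_disjoint mxrank0 => ->.
by rewrite mxrank_gen mxrank_tr mxrank_ker subnKC // rank_leq_row.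
Qed.

Lemma orthprojP (R : realType) (n p : nat) (W : 'M[R]_(n, p))
    (x y : 'cV[R]_n) :
  y = orthproj W x <->
  (exists c : 'cV[R]_p, y = W *m c) /\
  (forall c : 'cV[R]_p, (W *m c)^T *m (x - y) = 0).
Proof.
have dMk := ran_ker_disjoint W; split.
  move=> ->; rewrite /orthproj; split.
    have := proj_mx_sub <<W^T>>%MS (kermx W) x^T.
    rewrite genmxE => /submxP[c ->].
    by exists c^T; rewrite trmx_mul trmxK.
  move=> c; apply: trmx_inj; rewrite trmx_mul trmxK linearB/= trmxK mulmxA.
  have /sub_kermxP -> := proj_mx_compl_sub (ran_ker_full W x^T).
  by rewrite mul0mx trmx0.
move=> [[c yE] xyW]; apply: trmx_inj; rewrite /orthproj trmxK.
rewrite -[in RHS](subrK y x) linearD/= mulmxDl.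
rewrite proj_mx_0 ?add0r ?proj_mx_id//.
  by rewrite genmxE yE trmx_mul submxMl.
apply/sub_kermxP; apply: trmx_inj; rewrite trmx_mul trmxK trmx0.
apply/row_matrixP => i; rewrite row0 row_mul.
have := xyW (delta_mx i ord0).
by rewrite trmx_mul trmx_delta -rowE.
Qed.

Lemma orthproj_full_rank (R : realType) (n p : nat) (W : 'M[R]_(n, p))
    (x : 'cV[R]_n) :
  W^T *m W \in unitmx ->
  orthproj W x = W *m invmx (W^T *m W) *m W^T *m x.
Proof.
move=> Wu; apply/esym/orthprojP; split.
  by exists (invmx (W^T *m W) *m W^T *m x); rewrite !mulmxA.
move=> c; rewrite trmx_mul -mulmxA mulmxBr -!mulmxA.
by rewrite [W^T *m (W *m _)]mulmxA mulKVmx ?subrr ?mulmx0.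
Qed.

(* Main.v *)
Require Import Defs.
From HB Require Import structures.
From mathcomp Require Import all_boot all_order all_algebra.
From mathcomp Require Import all_classical all_reals all_analysis.
From mathcomp Require Import lra.
Import Order.TTheory GRing.Theory Num.Theory.
Import numFieldNormedType.Exports.
Local Open Scope classical_set_scope.
Local Open Scope ring_scope.

(* Each projection step from p to p' obeys Pythagoras,
   |x - p|^2 = |x - p'|^2 + |p' - p|^2, and A_i (x - p') = 0. Along one sweep
   from p to q the iterate therefore drifts, after block i, by an amount
   controlled by d = |x - p|^2 - |x - q|^2, so every entry of A (x - q) has
   square at most C d with C independent of p. As |x - x_s|^2 is nonincreasing
   and nonnegative, d tends to 0 along the process, hence so does A (x - x_s).
   Finally A has a left inverse on ran(A'), which contains every x_s and the
   projection of x. *)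

Set Implicit Arguments.
Unset Strict Implicit.

Lemma enorm_sqr (R : realType) (n : nat) (v : 'cV[R]_n) :
  enorm v ^+ 2 = \sum_i v i ord0 ^+ 2.
Proof. by rewrite sqr_sqrtr// sumr_ge0// => i _; exact: sqr_ge0. Qed.

Lemma enorm_sqr_mul (R : realType) (n : nat) (v : 'cV[R]_n) :
  enorm v ^+ 2 = (v^T *m v) ord0 ord0.
Proof.
by rewrite enorm_sqr mxE; apply: eq_bigr => i _; rewrite mxE expr2.
Qed.

Lemma normr_entry_le (R : realType) (n : nat) (v : 'cV[R]_n) (i : 'I_n) :
  `|v i ord0| <= enorm v.
Proof.
rewrite -sqrtr_sqr ler_wsqrtr// (bigD1 i)//= lerDl sumr_ge0// => j _.
exact: sqr_ge0.
Qed.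

Lemma enorm_sqrD_le (R : realType) (n : nat) (u v : 'cV[R]_n) :
  enorm (u + v) ^+ 2 <= 2 * enorm u ^+ 2 + 2 * enorm v ^+ 2.
Proof.
rewrite !enorm_sqr !mulr_sumr -big_split/=; apply: ler_sum => i _.
rewrite mxE; have := sqr_ge0 (u i ord0 - v i ord0); rewrite !expr2; nra.
Qed.

Lemma enorm_sqrD_orth (R : realType) (n : nat) (u v : 'cV[R]_n) :
  v^T *m u = 0 -> enorm (u + v) ^+ 2 = enorm u ^+ 2 + enorm v ^+ 2.
Proof.
move=> vu0; have uv0 : u^T *m v = 0.
  by apply: trmx_inj; rewrite trmx_mul trmxK vu0 trmx0.
rewrite !enorm_sqr_mul mulmxDr linearD/= !mulmxDl vu0 uv0.
by rewrite addr0 add0r mxE.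
Qed.

(** A crude constant, the sum of all absolute entries of [A], serves every row [r] at once. *)
Lemma mulmx_entry_sqr_le (R : realType) (m n : nat) (A : 'M[R]_(m, n))
    (v : 'cV[R]_n) (r : 'I_m) :
  (A *m v) r ord0 ^+ 2 <= (\sum_i \sum_j `|A i j|) ^+ 2 * enorm v ^+ 2.
Proof.
have sum_ge0 i : 0 <= \sum_j `|A i j| by rewrite sumr_ge0.
rewrite -exprMn -real_normK ?num_real//.
rewrite lerXn2r ?nnegrE ?mulr_ge0 ?sumr_ge0 ?sqrtr_ge0//.
apply: (@le_trans _ _ ((\sum_j `|A r j|) * enorm v)).
  rewrite mxE mulr_suml (le_trans (ler_norm_sum _ _ _))// ler_sum// => j _.
  by rewrite normrM ler_wpM2l ?normr_entry_le.
by rewrite ler_wpM2r ?sqrtr_ge0// (bigD1 r)//= lerDl sumr_ge0.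
Qed.

Lemma orthproj_perp (R : realType) (n p : nat) (W : 'M[R]_(n, p))
    (x : 'cV[R]_n) :
  W^T *m (x - orthproj W x) = 0.
Proof.
apply: trmx_inj; rewrite trmx0 trmx_mul trmxK linearB/= /orthproj trmxK.
by apply/sub_kermxP; rewrite proj_mx_compl_sub// ran_ker_full.
Qed.

Lemma orthproj_sub (R : realType) (n p : nat) (W : 'M[R]_(n, p))
    (x : 'cV[R]_n) :
  ((orthproj W x)^T <= W^T)%MS.
Proof. by rewrite /orthproj trmxK -(genmxE W^T) proj_mx_sub. Qed.

Lemma row_block_sub (R : realType) (m n : nat) (A : 'M[R]_(m, n))
    (S : {set 'I_m}) :
  (row_block A S <= A)%MS.
Proof. exact: rowsub_sub. Qed.

Lemma ap_step_sub (R : realType) (m n : nat) (A : 'M[R]_(m, n))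
    (x p : 'cV[R]_n) (S : {set 'I_m}) :
  (p^T <= A)%MS -> ((ap_step A x p S)^T <= A)%MS.
Proof.
move=> pA; rewrite (submx_trans (orthproj_sub _ _))//.
by rewrite tr_row_mx trmxK col_mx_sub pA row_block_sub.
Qed.

Lemma ap_step_block (R : realType) (m n : nat) (A : 'M[R]_(m, n))
    (x p : 'cV[R]_n) (S : {set 'I_m}) (r : 'I_m) :
  r \in S -> (A *m (x - ap_step A x p S)) r ord0 = 0.
Proof.
move=> rS; have := orthproj_perp (row_mx p (row_block A S)^T) x.
rewrite -/(ap_step A x p S) tr_row_mx trmxK mul_col_mx => /eqP.
(* The lower block of the orthogonality relation is [A_i (x - p') = 0]; [enum_rank_in rS r] is the
   position of row [r] in that block. *)
rewrite col_mx_eq0 => /andP[_ /eqP/matrixP/(_ (enum_rank_in rS r) ord0)].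
by rewrite mul_rowsub_mx !mxE enum_rankK_in.
Qed.

Lemma ap_step_pythagoras (R : realType) (m n : nat) (A : 'M[R]_(m, n))
    (x p : 'cV[R]_n) (S : {set 'I_m}) :
  enorm (x - p) ^+ 2 =
  enorm (x - ap_step A x p S) ^+ 2 + enorm (ap_step A x p S - p) ^+ 2.
Proof.
rewrite -enorm_sqrD_orth ?subrKA//.
set W := row_mx p (row_block A S)^T.
(* Since [p] is itself a column of [W], the displacement stays in ran(W), hence is orthogonal to the
   new residual. *)
have /submxP[c pE] : ((ap_step A x p S - p)^T <= W^T)%MS.
  rewrite linearB/= addmx_sub// ?orthproj_sub// eqmx_opp.
  by rewrite tr_row_mx -addsmxE addsmxSl.
by rewrite pE -mulmxA orthproj_perp mulmx0.
Qed.

(** The drift bound on [q - p] is carried along for the induction: the residual of the head block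
    vanishes right after its step, and later steps change it only through the drift. *)
Lemma ap_foldl_bound (R : realType) (m n k : nat) (A : 'M[R]_(m, n))
    (B : 'I_k -> {set 'I_m}) (x : 'cV[R]_n) (l : seq 'I_k) :
  exists2 C : R, 0 <= C & forall p,
    let q := foldl (fun p i => ap_step A x p (B i)) p l in
    let d := enorm (x - p) ^+ 2 - enorm (x - q) ^+ 2 in
    [/\ 0 <= d, enorm (q - p) ^+ 2 <= C * d &
      forall i r, i \in l -> r \in B i -> (A *m (x - q)) r ord0 ^+ 2 <= C * d].
Proof.
elim: l => [|i l [C C0 IH]].
  exists 0 => // p /=; split=> //; rewrite !subrr ?mul0r// enorm_sqr big1//.
  by move=> i _; rewrite mxE expr0n.
set K := (\sum_i \sum_j `|A i j|) ^+ 2; have K0 : 0 <= K by exact: sqr_ge0.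
have KC0 : 0 <= K * C by rewrite mulr_ge0.
(* [2 * C + 2] pays for the drift, split at [p1]; [K * C] for the head block; [C] for the blocks of
   the tail. *)
exists (2 * C + 2 + K * C + C); first by lra.
move=> p; set p1 := ap_step A x p (B i); have /= := IH p1.
set q := foldl _ p1 l; move=> [d0 qp1 Aq].
have pyth := ap_step_pythagoras A x p (B i); rewrite -/p1 in pyth.
have e0 : 0 <= enorm (p1 - p) ^+ 2 by exact: sqr_ge0.
move: d0 qp1 Aq; set dq := _ - _ => d0 qp1 Aq /=; rewrite -/p1 -/q.
have -> : enorm (x - p) ^+ 2 - enorm (x - q) ^+ 2 = dq + enorm (p1 - p) ^+ 2.
  by rewrite pyth /dq addrAC.
set e := enorm (p1 - p) ^+ 2 in e0 *.
have [Cd Ce] : 0 <= C * dq /\ 0 <= C * e by split; rewrite mulr_ge0.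
have [KCd KCe] : 0 <= K * C * dq /\ 0 <= K * C * e by split; rewrite mulr_ge0.
split; first by rewrite addr_ge0.
  rewrite -(subrKA p1) (le_trans (enorm_sqrD_le _ _))// -/e; nra.
move=> j r; rewrite inE => /predU1P[->|jl] rB; last first.
  by apply: le_trans (Aq _ _ jl rB) _; nra.
(* Row [r] of [A (x - p1)] is zero, so only the drift after [p1] contributes. *)
have -> : (A *m (x - q)) r ord0 = - (A *m (q - p1)) r ord0.
  have := ap_step_block A x p rB; rewrite -/p1 -(subrKA q) mulmxDr mxE.
  by move=> /eqP; rewrite addr_eq0 => /eqP.
rewrite sqrrN (le_trans (mulmx_entry_sqr_le _ _ _))// -/K.
have : K * enorm (q - p1) ^+ 2 <= K * (C * dq) by rewrite ler_wpM2l.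
nra.
Qed.

Lemma mulmx_left_inverse_row_space (R : realType) (m n : nat)
    (A : 'M[R]_(m, n)) :
  exists M : 'M[R]_(n, m), forall v : 'cV[R]_n,
    (v^T <= A)%MS -> M *m (A *m v) = v.
Proof.
(* If [A A'] kills the columns of a matrix [N], then [(A' N)' (A' N) = 0], so [A' N = 0]; here [N]
   is the cokernel of [A A']. *)
have sub : (A^T <= A *m A^T)%MS.
  rewrite submxE; apply/eqP; set K := A^T *m _.
  have KK0 : K^T *m K = 0.
    by rewrite trmx_mul trmxK /K -mulmxA (mulmxA A) mulmx_coker mulmx0.
  apply: trmx_inj; apply/row_matrixP => i; rewrite trmx0 row0.
  apply: mulmx_tr_eq0.
  by rewrite tr_row trmxK colE mulmxA -row_mul KK0 row0 mul0mx.
exists (A^T *m pinvmx (A *m A^T)) => v /submxP[c /(congr1 trmx)].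
rewrite trmxK trmx_mul => ->.
by rewrite (mulmxA A) mulmxA mulmxKpV.
Qed.

(** The matrix norm is a maximum over finitely many entries, so the entrywise estimates eventually
    hold simultaneously. *)
Lemma cvg_mx (R : realType) (m n : nat) (u : nat -> 'M[R]_(m, n))
    (M : 'M[R]_(m, n)) :
  (forall i j, u s i j @[s --> \oo] --> M i j) -> u s @[s --> \oo] --> M.
Proof.
move=> uM; apply/cvgrPdist_le => /= e e0; near=> s.
rewrite /Num.Def.normr/= mx_normrE (bigmax_le _ (ltW e0))//= => i _.
rewrite !mxE; move: i; near: s; apply: filter_forall => /= i.
exact: (cvgrPdist_le _ _).1 (uM i.1 i.2) e e0.
Unshelve. all: by end_near. Qed.

Lemma ap_sweep_bound (R : realType) (m n k : nat) (A : 'M[R]_(m, n))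
    (B : 'I_k -> {set 'I_m}) (x : 'cV[R]_n)
    (coverB : forall r : 'I_m, exists i : 'I_k, r \in B i) :
  exists2 C : R, 0 <= C & forall p,
    let d := enorm (x - p) ^+ 2 - enorm (x - ap_sweep A B x p) ^+ 2 in
    0 <= d /\ forall r, (A *m (x - ap_sweep A B x p)) r ord0 ^+ 2 <= C * d.
Proof.
have [C C0 CP] := ap_foldl_bound A B x (enum 'I_k).
exists C => // p; have [d0 _ Aq] := CP p; split=> // r.
by have [i rBi] := coverB r; apply: (Aq i) => //; rewrite mem_enum.
Qed.

Lemma ap_sweep_sub (R : realType) (m n k : nat) (A : 'M[R]_(m, n))
    (B : 'I_k -> {set 'I_m}) (x p : 'cV[R]_n) :
  (p^T <= A)%MS -> ((ap_sweep A B x p)^T <= A)%MS.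
Proof.
rewrite /ap_sweep; elim: (enum _) p => //= i l IH p pA.
by apply: IH; exact: ap_step_sub.
Qed.

Lemma sap_sub (R : realType) (m n k : nat) (A : 'M[R]_(m, n))
    (B : 'I_k -> {set 'I_m}) (x : 'cV[R]_n) (b : 'cV[R]_m) (s : nat) :
  ((sap A B x b s)^T <= A)%MS.
Proof.
elim: s => [|s IH]; last exact: ap_sweep_sub.
by rewrite /sap/= /sap_init linearZ/= scalemx_sub// trmx_mul trmxK submxMl.
Qed.

Lemma cvg_sap_residual (R : realType) (m n k : nat) (A : 'M[R]_(m, n))
    (B : 'I_k -> {set 'I_m}) (x : 'cV[R]_n) (b : 'cV[R]_m)
    (coverB : forall r : 'I_m, exists i : 'I_k, r \in B i) (r : 'I_m) :
  (A *m (x - sap A B x b s)) r ord0 @[s --> \oo] --> 0.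
Proof.
have [C C0 CP] := ap_sweep_bound A x coverB.
pose a s := enorm (x - sap A B x b s) ^+ 2.
have a_cvg : cvgn a.
  apply: nonincreasing_is_cvgn; last by exists 0 => _ [s _ <-]; exact: sqr_ge0.
  apply/nonincreasing_seqP => s.
  by rewrite -subr_ge0; have [] := CP (sap A B x b s).
(* The decrease from step [s] to [s.+1] controls the residual after the sweep, hence the shift of
   index. *)
rewrite -cvg_shiftS; apply: norm_cvg0.
have lim0 : Num.sqrt (C * (a s - a s.+1)) @[s --> \oo] --> (0 : R).
  rewrite -[X in _ --> X]sqrtr0.
  apply: (@continuous_cvg _ _ _ _ _ _ (@Num.sqrt R)).
    exact: sqrt_continuous.
  rewrite -[X in _ --> X](mulr0 C) -(subrr (limn a)).
  apply: cvgM; first exact: cvg_cst.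
  by apply: cvgB => //; rewrite cvg_shiftS.
apply: squeeze_cvgr (cvg_cst 0) lim0; near=> s.
rewrite normr_ge0/= -sqrtr_sqr ler_wsqrtr//.
by have [_] := CP (sap A B x b s); exact.
Unshelve. all: by end_near. Qed.

Unset Implicit Arguments.
Set Strict Implicit.

Theorem theorem3p8 (R : realType) (m n k : nat) (A : 'M[R]_(m, n))
    (B : 'I_k -> {set 'I_m}) (x : 'cV[R]_n) (b : 'cV[R]_m)
    (le_mn : (m <= n)%N) (coverB : forall r : 'I_m, exists i : 'I_k, r \in B i)
    (b_neq0 : b != 0) (Axb : A *m x = b) :
  (sap A B x b s @[s --> \oo] --> orthproj A^T x) /\
  (forall mn : m = n, castmx (mn, erefl n) A \in unitmx -> orthproj A^T x = x).
Proof.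
have Ay : A *m (x - orthproj A^T x) = 0.
  by have := orthproj_perp A^T x; rewrite trmxK.
have yA := orthproj_sub A^T x; rewrite trmxK in yA.
(* From here the projection is any [y] in ran(A') with [A y = A x]. *)
move: (orthproj A^T x) Ay yA => y Ay yA; split; last first.
  move=> mn; case: n / mn x y A {B b b_neq0 Axb le_mn coverB} Ay yA
    => x y A Ay _ Au.
  by apply/eqP; rewrite eq_sym -subr_eq0 -(mulKmx Au (x - y)) Ay mulmx0.
have [M MP] := mulmx_left_inverse_row_space A.
pose u s := A *m (x - sap A B x b s).
(* Both [y] and the iterate lie in ran(A'), so [M] recovers their difference from its image under
   [A], which is the residual [u s]. *)
have sapE s : sap A B x b s = y - M *m u s.
  have -> : u s = A *m (y - sap A B x b s).
    by rewrite /u -(subrKA y) mulmxDr Ay add0r.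
  rewrite MP ?subKr// linearB/= addmx_sub ?eqmx_opp//.
  exact: sap_sub.
apply: cvg_mx => i j; rewrite ord1.
have entryE s : sap A B x b s i ord0 = y i ord0 - \sum_l M i l * u s l ord0.
  by rewrite sapE !mxE.
under eq_fun do rewrite entryE.
have lim_entry : y i ord0 - \sum_l M i l * u s l ord0 @[s --> \oo] -->
    y i ord0 - \sum_l M i l * 0.
  apply: cvgB; first exact: cvg_cst.
  apply: cvg_big => [|l _]; first exact: add_continuous.
  by apply: cvgM; [exact: cvg_cst | exact: cvg_sap_residual].
by rewrite big1 ?subr0 in lim_entry => // l _; rewrite mulr0.
Qed.
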